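(* Fix real numbers $0<\alpha<\beta\le 1/2$. For any irreducible discrete-time Markov chain on a finite state space, $$T(\alpha)\;\le\; T(\beta)+\left(\frac{1}{\alpha}-1\right)\cdot T(1-\beta)\;\le\;\frac{T(\beta)}{\alpha}.$$
   Context: For an irreducible discrete-time Markov chain $X=(X_t)_{t\ge 0}$ with finite state space $\Omega$ and stationary distribution $\pi$, the hitting time of $A\subseteq\Omega$ is $\tau_A=\min\{t\ge 0: X_t\in A\}$, and $\mathbb{E}_x$ denotes expectation for the chain started at $X_0=x$. For $\gamma\in(0,1)$, $$T(\gamma)=\max\{\mathbb{E}_x[\tau_A] : x\in\Omega,\ A\subseteq\Omega,\ \pi(A)\ge\gamma\}.$$ *)

(* Defs.v *)
From mathcomp Require Import all_boot all_order all_algebra.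
From mathcomp Require Import all_classical all_reals all_analysis.
Import Order.TTheory GRing.Theory Num.Theory.

Set Implicit Arguments.
Unset Strict Implicit.
Unset Printing Implicit Defensive.

Local Open Scope classical_set_scope.
Local Open Scope ring_scope.

Definition stochastic (R : realType) (S : finType) (p : S -> S -> R) : Prop :=
  (forall x y, 0 <= p x y) /\ (forall x, \sum_(y : S) p x y = 1).

Fixpoint transition_power (R : realType) (S : finType) (p : S -> S -> R)
    (t : nat) (x y : S) : R :=
  if t is u.+1 then \sum_(z : S) p x z * transition_power p u z y
  else (x == y)%:R.

Definition irreducible_chain (R : realType) (S : finType)
    (p : S -> S -> R) : Prop :=
  forall x y, exists t, 0 < transition_power p t x y.

Definition stationary_distribution (R : realType) (S : finType)
    (p : S -> S -> R) (pi : S -> R) : Prop :=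
  [/\ forall x, 0 <= pi x,
      \sum_(x : S) pi x = 1 &
      forall y, \sum_(x : S) pi x * p x y = pi y].

Definition history (T : Type) (S : finType) (X : nat -> T -> S)
    (n : nat) (s : nat -> S) : set T :=
  [set w | forall t, (t <= n)%N -> X t w = s t].

(* [Pr x] is the law of the chain started at [x]. The last clause is the Markov
   property P(X_{n+1} = s_{n+1} | X_0 = s_0, ..., X_n = s_n) = p s_n s_{n+1}
   with the conditional probability multiplied out; histories of probability
   zero are unconstrained by it, since both sides then vanish. *)
Definition markov_chain (R : realType) (d : measure_display)
    (T : measurableType d) (S : finType) (p : S -> S -> R)
    (Pr : S -> probability T R) (X : nat -> T -> S) : Prop :=
  [/\ stochastic p,
      forall t y, measurable (X t @^-1` [set y]),
      forall x, Pr x (X 0%N @^-1` [set x]) = 1%E &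
      forall x n (s : nat -> S),
        Pr x (history X n.+1 s) =
          (Pr x (history X n s) * (p (s n) (s n.+1))%:E)%E].

(* The infimum of the empty set being +oo, the value is +oo on trajectories that
   never visit [A]. *)
Definition hitting_time (R : realType) (T : Type) (S : finType)
    (X : nat -> T -> S) (A : {set S}) (w : T) : \bar R :=
  ereal_inf [set (t%:R)%:E | t in [set t : nat | X t w \in A]].

Definition expected_hitting_time (R : realType) (d : measure_display)
    (T : measurableType d) (S : finType) (Pr : S -> probability T R)
    (X : nat -> T -> S) (x : S) (A : {set S}) : \bar R :=
  (\int[Pr x]_w hitting_time R X A w)%E.

(* The base value -oo is never attained: the whole space is always admissible for
   gamma <= 1. *)
Definition max_hitting_time (R : realType) (d : measure_display)
    (T : measurableType d) (S : finType) (Pr : S -> probability T R)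
    (X : nat -> T -> S) (pi : S -> R) (gamma : R) : \bar R :=
  \big[maxe/-oo%E]_(xA : S * {set S} | gamma <= \sum_(y in xA.2) pi y)
    expected_hitting_time Pr X xA.1 xA.2.

(* Main.v *)
Require Import Defs.
From mathcomp Require Import all_boot all_order all_algebra.
From mathcomp Require Import all_classical all_reals all_analysis.
From mathcomp Require Import ring lra.
Import Order.TTheory GRing.Theory Num.Theory.

Set Implicit Arguments.
Unset Strict Implicit.
Unset Printing Implicit Defensive.

Local Open Scope ring_scope.

(** For a fixed target set A, the mean hitting time h_A(x) = E_x[tau_A] is the
least nonnegative function with h >= 1 + P h off A. Two facts about these
functions give the first inequality.

- Stopping at B on the way: if h_A <= c on B then h_A <= c + h_B everywhere
  (hitting_mean_le_via), since min(h_A, c + h_B) still satisfies the inequality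
  of which h_A is the least solution.

- Alternation: for disjoint A and C, if h_C <= M on A and h_A >= m on C, then
  pi(A) (M + m) <= M (stationary_mass_le_alternation). Send the stationary
  chain to A, then to C, then to A, and so on. Visits to A only occur in the
  phases heading to C; these last at most M on average, the others at least m,
  so by ergodicity A is occupied a proportion at most M / (M + m) of the time.

Take A with pi(A) >= alpha and x attaining T(alpha), put
k = (1/alpha - 1) T(1 - beta), and let C be the set where h_A > k. Were
pi(C) >= 1 - beta, alternation with M = T(1 - beta) and m = min_C h_A > k would
give alpha (M + m) <= M, that is m <= k, a contradiction. So the complement of
C has mass at least beta, is reached from x in mean time at most T(beta), and
A is then reached in mean time at most k.

The second inequality says that T(1 - beta) <= T(beta), which holds as
beta <= 1 - beta.

The ergodic theorem is avoided by following the distribution of the pair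
(state, phase) started from the stationary law: a suitable energy of this
distribution is bounded, yet would grow linearly in time if the alternation
inequality failed (phase_step). The link with the trajectory space is the
identity E_x[tau_A] = sum_n P_x(tau_A > n), where P_x(tau_A > n) satisfies a
one-step recursion that follows from the Markov property. *)

(** * Survival probabilities and mean hitting times *)

Section Survival.
Variables (R : realType) (S : finType) (p : S -> S -> R).
Hypothesis hp : stochastic p.

(** The probability that the first [n + 1] states of the chain started at [x]
    all avoid [A]. *)
Fixpoint survival (A : {set S}) (n : nat) (x : S) : R :=
  if x \in A then 0
  else if n is k.+1 then \sum_y p x y * survival A k y else 1.

Lemma survival_in (A : {set S}) n x : x \in A -> survival A n x = 0.
Proof. by case: n => [|n] /= ->. Qed.

Lemma survivalS (A : {set S}) n x :
  x \notin A -> survival A n.+1 x = \sum_y p x y * survival A n y.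
Proof. by move=> /= /negPf ->. Qed.

Lemma survival_ge0 (A : {set S}) n x : 0 <= survival A n x.
Proof.
have [p0 _] := hp.
elim: n x => [|n IH] x /=; case: ifP => // _.
by apply: sumr_ge0 => y _; rewrite mulr_ge0.
Qed.

Lemma kernel_sum_le (f g : S -> R) x :
  (forall y, f y <= g y) -> \sum_y p x y * f y <= \sum_y p x y * g y.
Proof. by case: hp => p0 _ fg; apply: ler_sum => y _; rewrite ler_wpM2l. Qed.

Lemma kernel_sum_cst (c : R) x : \sum_y p x y * c = c.
Proof. by case: hp => _ p1; rewrite -mulr_suml p1 mul1r. Qed.

Lemma survivalS_le (A : {set S}) n x : survival A n.+1 x <= survival A n x.
Proof.
elim: n x => [|n IH] x.
  have [xA|xA] := boolP (x \in A); first by rewrite !survival_in.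
  rewrite survivalS //= (negPf xA) -[leRHS](kernel_sum_cst 1 x).
  by apply: kernel_sum_le => y; case: ifP.
have [xA|xA] := boolP (x \in A); first by rewrite !survival_in.
by rewrite !(survivalS _ xA); apply: kernel_sum_le.
Qed.

(** Avoiding [A] up to time [n] and being at [a] at time [n] are disjoint
    events when [a] lies in [A]. *)
Lemma survival_add_transition_le1 (A : {set S}) a n x :
  a \in A -> survival A n x + transition_power p n x a <= 1.
Proof.
have [p0 p1] := hp; move=> aA; elim: n x => [|n IH] x.
  rewrite /=; case: ifP => xA; first by rewrite add0r lern1; case: eqP.
  by case: eqP xA => [->|_ _]; [rewrite aA | rewrite addr0].
have tge0 k z : 0 <= transition_power p k z a.
  elim: k z => [|k IHk] z /=; first by rewrite ler0n.
  by apply: sumr_ge0 => w _; rewrite mulr_ge0.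
have step : \sum_y p x y * survival A n y + transition_power p n.+1 x a <= 1.
  rewrite /= -big_split /= -[leRHS](kernel_sum_cst 1 x).
  under eq_bigr do rewrite -mulrDr.
  exact: kernel_sum_le.
have [xA|xA] := boolP (x \in A); last by rewrite survivalS.
rewrite survival_in // (le_trans _ step) // lerD2r.
by apply: sumr_ge0 => y _; rewrite mulr_ge0 // survival_ge0.
Qed.

Hypothesis hirr : irreducible_chain p.

(** Irreducibility makes survival uncertain from each state after some time,
    and finiteness of [S] with monotonicity makes time and gap uniform. *)
Lemma survival_uniformly_lt1 (A : {set S}) a : a \in A ->
  exists N, exists2 e : R, 0 < e & forall x, survival A N x <= 1 - e.
Proof.
move=> aA.
have lt1 x : exists n, survival A n x < 1.
  have [t tpos] := hirr x a; exists t.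
  by have := survival_add_transition_le1 t x aA; lra.
have [n hn] := choice lt1.
pose N := \max_x n x.
have decr k l x : (k <= l)%N -> survival A l x <= survival A k x.
  move=> /subnK <-; elim: (l - k)%N => [//|j IH].
  by rewrite addSn (le_trans (survivalS_le _ _ _)).
have ltN x : survival A N x < 1.
  by apply: le_lt_trans (hn x); apply: decr; exact: leq_bigmax.
exists N, (\big[Num.min/1]_x (1 - survival A N x)).
  by apply: lt_bigmin => // x _; rewrite subr_gt0.
move=> x; rewrite lerBrDr -lerBrDl.
exact: bigmin_le_cond.
Qed.

Definition supersolution (A : {set S}) (H : S -> R) : Prop :=
  (forall x, 0 <= H x) /\
  (forall x, x \notin A -> 1 + \sum_y p x y * H y <= H x).

(** First-step analysis for the truncated mean E_x[min(tau_A, n)]. *)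
Lemma sum_survival_recr (A : {set S}) n x : x \notin A ->
  \sum_(0 <= k < n.+1) survival A k x =
  1 + \sum_y p x y * \sum_(0 <= k < n) survival A k y.
Proof.
move=> xA; rewrite big_nat_recl //= (negPf xA); congr (_ + _).
by rewrite exchange_big /=; apply: eq_bigr => y _; rewrite mulr_sumr.
Qed.

Lemma sum_survival_le_supersolution (A : {set S}) H n x :
  supersolution A H -> \sum_(0 <= k < n) survival A k x <= H x.
Proof.
case=> H0 HP; elim: n x => [|n IH] x; first by rewrite big_geq.
have [xA|xA] := boolP (x \in A).
  by rewrite big1 // => k _; rewrite survival_in.
rewrite sum_survival_recr // (le_trans _ (HP _ xA)) // lerD2l.
exact: kernel_sum_le.
Qed.

(** A finite supersolution is what makes mean hitting times finite. The
    truncated mean up to time [N] loses exactly [1 - survival A N x >= e] in one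
    step off [A], so that dividing it by [e] gives a loss of at least 1. *)
Lemma supersolution_exists (A : {set S}) a :
  a \in A -> exists H, supersolution A H.
Proof.
move=> /survival_uniformly_lt1[N [e e0 hN]].
exists (fun x => e^-1 * \sum_(0 <= k < N) survival A k x); split.
  move=> x; rewrite mulr_ge0 ?invr_ge0 ?(ltW e0) //.
  by apply: sumr_ge0 => k _; exact: survival_ge0.
move=> x xA.
under eq_bigr do rewrite mulrCA.
rewrite -mulr_sumr.
have := sum_survival_recr N xA; rewrite big_nat_recr //= => eqs.
rewrite -ler_pdivrMl ?invr_gt0 // invrK mulrDr mulr1 mulrA mulfV ?gt_eqF // mul1r.
have := hN x; lra.
Qed.

(** Being the least supersolution, rather than just a solution of the
    first-step equations, is what makes mean hitting times comparable. *)
Definition hitting_mean (A : {set S}) (h : S -> R) : Prop :=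
  [/\ forall x, x \in A -> h x = 0,
      forall x, x \notin A -> h x = 1 + \sum_y p x y * h y,
      forall x, 0 <= h x &
      forall H, supersolution A H -> forall x, h x <= H x].

Lemma survival_series (A : {set S}) a : a \in A ->
  exists2 h, hitting_mean A h &
    forall x, (\sum_(n <oo) (survival A n x)%:E)%E = (h x)%:E.
Proof.
have [p0 p1] := hp; move=> aA.
have [H0 sH0] := supersolution_exists aA.
pose E x := (\sum_(n <oo) (survival A n x)%:E)%E.
have sge0 x n : xpredT n -> (0 <= (survival A n x)%:E)%E.
  by move=> _; rewrite lee_fin survival_ge0.
have E0 x : (0 <= E x)%E by apply: nneseries_ge0 => n _; exact: sge0.
have Ele H x : supersolution A H -> (E x <= (H x)%:E)%E.
  move=> sH; apply: lime_le.
    by apply: is_cvg_nneseries => n _ _; exact: sge0.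
  apply: nearW => n; rewrite sumEFin lee_fin.
  exact: sum_survival_le_supersolution.
have Efin x : E x \is a fin_num.
  by rewrite ge0_fin_numE // (le_lt_trans (Ele _ _ sH0)) // ltry.
have fE x : E x = (fine (E x))%:E by rewrite fineK.
exists (fun x => fine (E x)) => //; split.
- move=> x xA; rewrite /E eseries0 // => n _ _; by rewrite survival_in.
- move=> x xA; apply: EFin_inj; rewrite -fE EFinD -sumEFin.
  under eq_bigr do rewrite EFinM -fE.
  rewrite {1}/E nneseries_recl //; last exact: sge0.
  rewrite /= (negPf xA); congr (_ + _)%E.
  rewrite -nneseries_addn; last by move=> n; exact: sge0.
  under eq_eseriesr => n _.
    rewrite addn1 survivalS // -sumEFin.
    under eq_bigr do rewrite EFinM.
    over.
  rewrite nneseries_sum; last first.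
    by move=> y n _; rewrite -EFinM lee_fin mulr_ge0 // survival_ge0.
  by apply: eq_bigr => y _; rewrite nneseriesZl // => n _; exact: sge0.
- by move=> x; rewrite fine_ge0.
- by move=> H sH x; rewrite -lee_fin -fE; exact: Ele.
Qed.

(** Reaching [A] by way of [B]: the minimum of [h] and [c + g] is a
    supersolution for [A]. On [B] this holds because the minimum is [h]
    there, elsewhere because both functions are supersolutions. *)
Lemma hitting_mean_le_via (A B : {set S}) h g c :
  hitting_mean A h -> hitting_mean B g -> 0 <= c ->
  (forall y, y \in B -> h y <= c) -> forall x, h x <= c + g x.
Proof.
case=> _ hP h0 hmin [_ gP g0 _] c0 hc x.
suff /hmin/(_ x) : supersolution A (fun y => Num.min (h y) (c + g y)).
  by move=> /le_trans; apply; rewrite ge_min lexx orbT.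
split=> [y|y yA]; first by rewrite le_min h0 addr_ge0.
have leh : 1 + \sum_z p y z * Num.min (h z) (c + g z) <= h y.
  rewrite hP // lerD2l; apply: kernel_sum_le => z; rewrite ge_min lexx //.
rewrite le_min leh /=.
have [yB|yB] := boolP (y \in B).
  by rewrite (le_trans leh) // (le_trans (hc _ yB)) // lerDl.
have : \sum_z p y z * Num.min (h z) (c + g z) <= \sum_z p y z * (c + g z).
  by apply: kernel_sum_le => z; rewrite ge_min lexx orbT.
under [leRHS]eq_bigr do rewrite mulrDr.
by rewrite big_split /= kernel_sum_cst (gP _ yB); lra.
Qed.

End Survival.

(** * Alternating between two sets under the stationary law *)

Section Stationary.
Variables (R : realType) (S : finType) (p : S -> S -> R) (pi : S -> R).
Hypothesis hp : stochastic p.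
Hypothesis hpi : stationary_distribution p pi.

Section Alternation.
Variables (A C : {set S}) (h g : S -> R) (M m : R).
Hypothesis hA : hitting_mean p A h.
Hypothesis gC : hitting_mean p C g.
Hypothesis dAC : [disjoint A & C].
Hypothesis gM : forall x, x \in A -> g x <= M.
Hypothesis hm : forall x, x \in C -> m <= h x.
Hypothesis M0 : 0 <= M.
Hypothesis m0 : 0 <= m.

(** [nu x] is the probability of being at [x] in a phase heading to [A], and
    [pi x - nu x] that of being at [x] in a phase heading to [C]: together the
    phases carry the stationary law. On entering a target the phase switches,
    which forces the values of [nu] on [A] and [C]. *)
Definition phase_measure (nu : S -> R) : Prop :=
  [/\ forall x, 0 <= nu x <= pi x,
      forall x, x \in A -> nu x = 0 &
      forall x, x \in C -> nu x = pi x].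

(** While heading to [A] the potential [M * h] drops on average by [M] per
    step; while heading to [C] the potential [m * (M - g)] rises by [m]. The
    bounds on [g] and [h] are such that a change of phase never lowers the
    potential: it goes from 0 to [m * (M - g) >= 0] on [A], and from [m * M] to
    [M * h >= M * m] on [C]. *)
Definition phase_energy (nu : S -> R) : R :=
  \sum_x (nu x * (M * h x) + (pi x - nu x) * (m * (M - g x))).

(** The mass [b] heading to [C] is at least that of [A], so one step changes
    the energy by at least [m * b - M * (1 - b)], which is at least the stated
    increment. *)
Lemma phase_step nu : phase_measure nu ->
  exists2 nu', phase_measure nu' &
    phase_energy nu + ((M + m) * \sum_(x in A) pi x - M) <= phase_energy nu'.
Proof.
have [p0 p1] := hp; have [pi0 pi1 piP] := hpi.
have [h0 hP hge0 _] := hA; have [g0 gP gge0 _] := gC.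
case=> nub nuA nuC.
pose q y := \sum_x nu x * p x y.
have q0 y : 0 <= q y.
  by apply: sumr_ge0 => x _; rewrite mulr_ge0 //; case/andP: (nub x).
have qpi y : q y <= pi y.
  rewrite -(piP y); apply: ler_sum => x _; rewrite ler_wpM2r //.
  by case/andP: (nub x).
exists (fun y => if y \in A then 0 else if y \in C then pi y else q y).
  split=> y.
  - by case: ifP => _; [rewrite lexx pi0 | case: ifP => _; rewrite ?pi0 ?q0 ?lexx ?qpi].
  - by move=> ->.
  - by move=> yC; rewrite yC (disjointFl dAC yC).
(* [q] is the pushed mass before any phase change; phase changes only raise
   the energy, and it remains to compute the energy of the pushed masses. *)
apply: (@le_trans _ _
   (\sum_y (q y * (M * h y) + (pi y - q y) * (m * (M - g y))))); last first.
  apply: ler_sum => y _; have qy := q0 y; have qpy := qpi y.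
  case: ifP => yA.
    rewrite h0 //; have ? : 0 <= q y * (m * (M - g y)).
      by rewrite !mulr_ge0 // subr_ge0 gM.
    lra.
  case: ifP => yC //.
  rewrite g0 //; have ? : 0 <= (pi y - q y) * (M * (h y - m)).
    by rewrite !mulr_ge0 // subr_ge0 // hm.
  lra.
have push (f : S -> R) (mu : S -> R) :
    \sum_y (\sum_x mu x * p x y) * f y = \sum_x mu x * \sum_y p x y * f y.
  under eq_bigr do rewrite mulr_suml.
  rewrite exchange_big /=; apply: eq_bigr => x _.
  by rewrite mulr_sumr; apply: eq_bigr => y _; rewrite mulrA.
have qh : \sum_y q y * h y = \sum_x nu x * (h x - 1).
  rewrite push; apply: eq_bigr => x _.
  have [xA|xA] := boolP (x \in A); first by rewrite nuA // !mul0r.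
  by congr (_ * _); rewrite [h x]hP // addrC addKr.
have qg : \sum_y (pi y - q y) * g y = \sum_x (pi x - nu x) * (g x - 1).
  transitivity (\sum_y (\sum_x (pi x - nu x) * p x y) * g y).
    apply: eq_bigr => y _; congr (_ * _).
    by under [RHS]eq_bigr do rewrite mulrBl; rewrite sumrB piP.
  rewrite push; apply: eq_bigr => x _.
  have [xC|xC] := boolP (x \in C); first by rewrite nuC // subrr !mul0r.
  by congr (_ * _); rewrite [g x]gP // addrC addKr.
have qsum : \sum_y q y = \sum_x nu x.
  rewrite exchange_big /=; apply: eq_bigr => x _.
  by rewrite -mulr_sumr p1 mulr1.
have energyE (mu : S -> R) :
    \sum_y (mu y * (M * h y) + (pi y - mu y) * (m * (M - g y))) =
    M * (\sum_y mu y * h y) + m * M * (1 - \sum_y mu y)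
      - m * \sum_y (pi y - mu y) * g y.
  rewrite -pi1 -sumrB !mulr_sumr -big_split -sumrB /=.
  by apply: eq_bigr => y _; ring.
rewrite /phase_energy !energyE qh qg qsum.
have -> : \sum_x nu x * (h x - 1) = \sum_x nu x * h x - \sum_x nu x.
  by rewrite -sumrB; apply: eq_bigr => x _; rewrite mulrBr mulr1.
have -> : \sum_x (pi x - nu x) * (g x - 1) =
    \sum_x (pi x - nu x) * g x - (1 - \sum_x nu x).
  rewrite -[X in X - \sum_x nu x]pi1 -!sumrB.
  by apply: eq_bigr => x _; rewrite mulrBr mulr1.
have nuS : \sum_x nu x + \sum_(x in A) pi x <= 1.
  rewrite -pi1 (bigID (mem A) predT nu) (bigID (mem A) predT pi) /=.
  rewrite [X in X + _ + _]big1 => [|x xA]; last exact: nuA.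
  rewrite add0r [leLHS]addrC lerD2l; apply: ler_sum => x _.
  by case/andP: (nub x).
have ? : 0 <= (M + m) * (1 - (\sum_x nu x + \sum_(x in A) pi x)).
  by apply: mulr_ge0; [exact: addr_ge0 | rewrite subr_ge0].
lra.
Qed.

(** If the inequality failed, each step would raise the energy by a fixed
    positive amount, although the energy is bounded. *)
Lemma stationary_mass_le_alternation :
  (\sum_(x in A) pi x) * (M + m) <= M.
Proof.
have [pi0 _ _] := hpi.
have [_ _ hge0 _] := hA; have [_ _ gge0 _] := gC.
rewrite leNgt; apply/negP => gap.
pose d := (M + m) * \sum_(x in A) pi x - M.
have d0 : 0 < d by rewrite subr_gt0 mulrC.
(* Start heading to [A] from [C], and to [C] from everywhere else. *)
pose nu0 x := if x \in C then pi x else 0.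
have nu0P : phase_measure nu0.
  split=> x; rewrite /nu0; first by case: ifP => _; rewrite ?pi0 ?lexx.
  - by move=> xA; rewrite (disjointFr dAC xA).
  - by move=> ->.
have grow n : exists2 nu, phase_measure nu &
    phase_energy nu0 + n%:R * d <= phase_energy nu.
  elim: n => [|n [nu nuP le_nu]]; first by exists nu0; rewrite // mul0r addr0.
  have [nu' nu'P le_nu'] := phase_step nuP; exists nu' => //.
  by apply: le_trans le_nu'; rewrite -/d -natr1 mulrDl mul1r addrA lerD2r.
pose K := \sum_x pi x * (M * h x + m * M).
have bound nu : phase_measure nu -> phase_energy nu <= K.
  case=> nub _ _; apply: ler_sum => x _.
  have /andP[n0 n1] := nub x.
  have ? : 0 <= (pi x - nu x) * (M * h x) by rewrite !mulr_ge0 ?subr_ge0.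
  have ? : 0 <= nu x * (m * M) by rewrite !mulr_ge0.
  have ? : 0 <= (pi x - nu x) * (m * g x) by rewrite !mulr_ge0 ?subr_ge0.
  lra.
have [nu nuP] := grow (Num.trunc ((K - phase_energy nu0) / d)).+1.
have := bound _ nuP.
have := truncnS_gt ((K - phase_energy nu0) / d).
rewrite ltr_pdivrMr //; lra.
Qed.

End Alternation.
End Stationary.

(** * The law of the hitting time *)

Section Law.
Local Open Scope classical_set_scope.
Variables (R : realType) (d : measure_display) (T : measurableType d).
Variables (S : finType) (p : S -> S -> R) (Pr : S -> probability T R).
Variable X : nat -> T -> S.
Hypothesis hX : markov_chain p Pr X.

Definition avoids (A : {set S}) (k j : nat) : set T :=
  [set w | forall t, (k <= t <= k + j)%N -> X t w \notin A].

Lemma measurable_visit t (P : S -> Prop) : measurable [set w | P (X t w)].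
Proof.
have [_ mX _ _] := hX.
have -> : [set w | P (X t w)] = \bigcup_(y in [set y | P y]) (X t @^-1` [set y]).
  apply/seteqP; split => [w Pw|w [y Py Xw]]; last by rewrite /= Xw.
  by exists (X t w).
by apply: fin_bigcup_measurable => // y _; exact: mX.
Qed.

Lemma measurable_avoids A k j : measurable (avoids A k j).
Proof.
have -> : avoids A k j =
    \bigcap_(t in [set t | (k <= t <= k + j)%N]) [set w | X t w \notin A].
  by apply/seteqP; split.
apply: bigcap_measurable; first by exists k => /=; rewrite leqnn leq_addr.
by move=> t _; exact: (measurable_visit t (fun y => is_true (y \notin A))).
Qed.

Lemma measurable_history k s : measurable (history X k s).
Proof.
have -> : history X k s =
    \bigcap_(t in [set t | (t <= k)%N]) [set w | X t w = s t].
  by apply/seteqP; split.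
apply: bigcap_measurable; first by exists 0%N.
by move=> t _; exact: (measurable_visit t (fun y => y = s t)).
Qed.

(** Conditionally on the history up to time [k], avoiding [A] from time [k] to
    [k + j] has the survival probability of the current state. By induction on
    [j], splitting on the state at time [k + 1]; this needs histories of every
    length, whence the generality in [k] and [s]. *)
Lemma prob_history_avoids x A j k (s : nat -> S) :
  Pr x (history X k s `&` avoids A k j) =
  (Pr x (history X k s) * (survival p A j (s k))%:E)%E.
Proof.
have [hp mX hX0 hXS] := hX.
have inA i k' (s' : nat -> S) : s' k' \in A -> 
    history X k' s' `&` avoids A k' i = set0.
  move=> sA; apply/seteqP; split => // w [/= hw aw].
  by have := aw k'; rewrite leqnn leq_addr hw // sA => /(_ isT).
elim: j k s => [|j IH] k s.
  have [sA|sA] := boolP (s k \in A).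
    by rewrite inA // survival_in // mule0 measure0.
  rewrite /= (negPf sA) mule1; congr (Pr x _); apply/seteqP.
  split=> [w []//|w hw]; split=> // t.
  by rewrite addn0 -eqn_leq => /eqP <-; rewrite hw.
have [sA|sA] := boolP (s k \in A).
  by rewrite inA // survival_in // mule0 measure0.
pose ext y t := if t == k.+1 then y else s t.
have extk y : ext y k = s k by rewrite /ext ltn_eqF.
have exty y : ext y k.+1 = y by rewrite /ext eqxx.
have histE y : history X k (ext y) = history X k s.
  by apply/seteqP; split=> w hw t tk; rewrite hw // /ext ltn_eqF.
have -> : history X k s `&` avoids A k j.+1 =
    \bigcup_(y in [set: S]) (history X k.+1 (ext y) `&` avoids A k.+1 j).
  apply/seteqP; split=> [w [hw aw]|w [y _ [hw aw]]].
    exists (X k.+1 w) => //; split=> t.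
      by rewrite leq_eqVlt /ext; case: eqP => [->//|_ /= tk]; exact: hw.
    by move=> /andP[kt tj]; apply: aw; rewrite (ltnW kt) addnS -addSn.
  have hws : history X k s w by rewrite -(histE y) => t tk; exact/hw/leqW.
  split=> // t; rewrite leq_eqVlt => /andP[/orP[/eqP <- _|kt tj]].
    by rewrite hws.
  by apply: aw; rewrite kt addSn -addnS.
rewrite measure_fin_bigcup; [|exact: finite_finset| |]; first last.
- by move=> y _; apply: measurableI; [exact: measurable_history|exact: measurable_avoids].
- move=> y z _ _ [w [[hy _] [hz _]]].
  by have := hy k.+1 (leqnn _); rewrite hz // /ext eqxx.
rewrite (fsbigE (index_enum S)) => [||//|y _]; first last.
- by rewrite mem_index_enum.
- exact: index_enum_uniq.
rewrite (eq_bigl xpredT) => [|y]; last by rewrite in_setT.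
rewrite survivalS // -sumEFin ge0_sume_distrr; last first.
  by have [p0 _] := hp => y _; rewrite lee_fin mulr_ge0 // survival_ge0.
apply: eq_bigr => y _.
etransitivity; first exact: IH.
by rewrite hXS histE extk exty EFinM muleA.
Qed.

Lemma prob_avoids x A n : Pr x (avoids A 0 n) = (survival p A n x)%:E.
Proof.
have [_ mX hX0 _] := hX.
have histE : history X 0 (fun=> x) = X 0%N @^-1` [set x].
  apply/seteqP; split=> w hw; first exact: hw.
  by move=> t; rewrite leqn0 => /eqP ->.
have := prob_history_avoids x A n 0 (fun=> x).
rewrite histE hX0 mul1e => <-.
have mav := measurable_avoids A 0 n.
(* The chain starts at [x] only almost surely, so the null event of another
   starting point has to be discarded. *)
have P0 : Pr x (~` (X 0%N @^-1` [set x])) = 0%E.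
  by rewrite probability_setC // hX0 subee.
rewrite -[in LHS](setTI (avoids A 0 n)) -(setUv (X 0%N @^-1` [set x])) setIUl.
rewrite measureU //.
- rewrite [X in (_ + X)%E](_ : _ = 0%E) ?adde0 //.
  apply/eqP; rewrite eq_le measure_ge0 andbT -[leRHS]P0.
  apply: le_measure; last by move=> w [].
  + by rewrite inE; apply: measurableI => //; exact: measurableC.
  + by rewrite inE; exact: measurableC.
- exact: measurableI.
- by apply: measurableI => //; exact: measurableC.
- by rewrite setIACA setICr set0I.
Qed.

(** The layer-cake formula: [tau_A] counts the times [n] with [tau_A > n]. It
    also holds when [A] is never visited, both sides being infinite. *)
Lemma hitting_time_series A w :
  hitting_time R X A w = (\sum_(n <oo) (\1_(avoids A 0 n) w)%:E)%E.
Proof.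
have ge0 n : (0 <= (\1_(avoids A 0 n) w : R)%:E)%E by rewrite lee_fin.
have [[t0 ht0]|never] := pselect (exists t, X t w \in A).
  have ex : exists t, X t w \in A by exists t0.
  case: (ex_minnP ex) => N hN Nmin.
  have -> : hitting_time R X A w = (N%:R)%:E.
    apply/eqP; rewrite eq_le; apply/andP; split.
      by apply: ereal_inf_lbound; exists N.
    apply: le_ereal_inf_tmp => _ [t ht <-].
    by rewrite lee_fin ler_nat Nmin.
  rewrite (nneseries_split 0 N) // add0n eseries0 ?adde0; last first.
    move=> n Nn _; rewrite indicE memNset // => /(_ N).
    by rewrite add0n Nn hN => /(_ isT).
  rewrite (eq_big_nat _ _ (F2 := fun=> 1%E)); last first.
    move=> n /andP[_ nN]; rewrite indicE mem_set // => t /andP[_ tn].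
    by apply: contraL (leq_ltn_trans tn nN) => /Nmin; rewrite -leqNgt.
  by rewrite sumEFin sumr_const_nat subn0.
have -> : hitting_time R X A w = +oo%E.
  rewrite /hitting_time (_ : [set _ | _ in _] = set0) ?ereal_inf0 //.
  by apply/seteqP; split=> // y [t ht _]; case: never; exists t.
apply/esym/eqyP => a a0.
apply: le_trans (nneseries_lim_ge (Num.trunc a).+1 _); last by [].
rewrite /=.
rewrite (eq_bigr (fun=> 1%E)).
  by rewrite sumEFin sumr_const_nat subn0 lee_fin ltW // truncnS_gt.
move=> n _; rewrite indicE mem_set // => t _.
by apply/negP => ht; apply: never; exists t.
Qed.

Lemma expected_hitting_time_series x A :
  expected_hitting_time Pr X x A = (\sum_(n <oo) (survival p A n x)%:E)%E.
Proof.
rewrite /expected_hitting_time; under eq_integral do rewrite hitting_time_series.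
rewrite integral_nneseries //.
- apply: eq_eseriesr => n _; rewrite integral_indic //.
    by rewrite setIT; exact: prob_avoids.
  exact: measurable_avoids.
- move=> n; apply/measurable_realfun.measurable_EFinP.
  exact/measurable_realfun.measurable_indic/measurable_avoids.
Qed.

End Law.

(** * Comparison of the maximal mean hitting times *)

Section MaxHitting.
Variables (R : realType) (S : finType) (p : S -> S -> R) (pi : S -> R).
Variables (d : measure_display) (T : measurableType d).
Variables (Pr : S -> probability T R) (X : nat -> T -> S).
Hypothesis hX : markov_chain p Pr X.
Hypothesis hirr : irreducible_chain p.
Hypothesis hpi : stationary_distribution p pi.

Lemma expected_hitting_time_mean (A : {set S}) (c : R) :
  0 < c -> c <= \sum_(y in A) pi y ->
  exists2 h, hitting_mean p A h &
    forall x, expected_hitting_time Pr X x A = (h x)%:E.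
Proof.
move=> c0 cA; have [hp _ _ _] := hX.
have [A0|[a aA]] := set_0Vmem A.
  by move: cA; rewrite A0 big_set0 leNgt c0.
have [h hh Eh] := survival_series hp hirr aA; exists h => // x.
by rewrite (expected_hitting_time_series hX).
Qed.

(** The maximum is over a finite nonempty family of finite values, so it is a
    real number and is attained. *)
Lemma max_hitting_time_attained (c : R) : 0 < c -> c <= 1 ->
  exists t : R, [/\ max_hitting_time Pr X pi c = t%:E, 0 <= t,
    forall (A : {set S}) x, c <= \sum_(y in A) pi y ->
      (expected_hitting_time Pr X x A <= t%:E)%E &
    exists (A : {set S}) x, c <= \sum_(y in A) pi y /\
      expected_hitting_time Pr X x A = t%:E].
Proof.
move=> c0 c1; have [_ pi1 _] := hpi.
have [x0 _] : exists x0 : S, true.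
  have [x0 _|S0] := pickP (@predT S); first by exists x0.
  by move: pi1; rewrite big_pred0 // => /esym/eqP; rewrite oner_eq0.
pose P (xA : S * {set S}) := c <= \sum_(y in xA.2) pi y.
pose F (xA : S * {set S}) := expected_hitting_time Pr X xA.1 xA.2.
have PT : P (x0, [set: S]%SET).
  rewrite /P /= (eq_bigl xpredT) => [|y]; last by rewrite inE.
  by rewrite pi1.
have [[x A] PxA maxE] : {i0 | i0 \in P & \big[maxe/-oo%E]_(i | P i) F i = F i0}.
  by apply: (eq_bigmax (x0, [set: S]%SET)) => // i _; exact: leNye.
have [h [_ _ h0 _] Eh] := expected_hitting_time_mean c0 PxA.
exists (h x); split => //; first by rewrite /max_hitting_time maxE /F Eh.
- move=> B y cB; rewrite -Eh -/(F (x, A)) -maxE.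
  exact: (@le_bigmax_cond _ _ _ _ (y, B)).
- by exists A, x.
Qed.

(** The states from which [A] is far away have mass less than [1 - beta], by
    alternation between [A] and these states; their complement is then an
    admissible intermediate target for [beta]. *)
Lemma max_hitting_time_le_via (alpha beta a b c : R) :
  0 < alpha -> alpha <= 1 -> 0 < beta -> beta < 1 ->
  max_hitting_time Pr X pi alpha = a%:E ->
  max_hitting_time Pr X pi beta = b%:E ->
  max_hitting_time Pr X pi (1 - beta) = c%:E ->
  a <= b + (1 / alpha - 1) * c.
Proof.
move=> al0 al1 be0 be1; have [hp _ _ _] := hX; have [_ pi1 _] := hpi.
have [t [-> _ _ [A [x [alA Et]]]]] := max_hitting_time_attained al0 al1.
move=> [<-].
have [tb [-> _ tbmax _]] := max_hitting_time_attained be0 (ltW be1).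
move=> [<-].
have cb0 : 0 < 1 - beta by rewrite subr_gt0.
have cb1 : 1 - beta <= 1 by rewrite gerBl ltW.
have [tc [-> tc0 tcmax _]] := max_hitting_time_attained cb0 cb1.
move=> [<-].
have [h hA Eh] := expected_hitting_time_mean al0 alA.
have <- : h x = t by apply: EFin_inj; rewrite -Eh.
have [hA0 _ _ _] := hA.
set k := (1 / alpha - 1) * tc.
have k0 : 0 <= k.
  by rewrite mulr_ge0 // subr_ge0 div1r -[leLHS]invr1 lef_pV2 ?posrE ?ltr01.
pose C := [set y | k < h y].
have massC : \sum_(y in C) pi y < 1 - beta.
  rewrite ltNge; apply/negP => Cbig.
  have [g gC Eg] := expected_hitting_time_mean cb0 Cbig.
  have [C0|[c0 c0C]] := set_0Vmem C.
    by move: Cbig; rewrite C0 big_set0 leNgt cb0.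
  have dAC : [disjoint A & C].
    apply/pred0P => y /=; apply/negbTE/negP => /andP[yA].
    by rewrite inE hA0 // ltNge k0.
  case: (arg_minP h c0C) => c1 c1C hmin.
  have mpos : k < h c1 by have : c1 \in C := c1C; rewrite inE.
  have key : (\sum_(x in A) pi x) * (tc + h c1) <= tc.
    apply: (stationary_mass_le_alternation hp hpi hA gC dAC) => // [y yA|].
      by rewrite -lee_fin -Eg; exact: tcmax.
    exact: le_trans (ltW mpos).
  have : alpha * (tc + h c1) <= tc.
    apply: le_trans key; rewrite ler_wpM2r //.
    by rewrite addr_ge0 // (le_trans k0 (ltW mpos)).
  apply/negP; rewrite -ltNge.
  have tcE : tc = alpha * (tc + k) by rewrite /k; field; rewrite gt_eqF.
  by rewrite [ltLHS]tcE ltr_pM2l // ltrD2l.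
have massB : beta <= \sum_(y in ~: C) pi y.
  have := pi1; rewrite (bigID (mem C)) /=.
  rewrite [X in _ + X](eq_bigl (mem (~: C))) => [|y]; last by rewrite !inE.
  by move: massC => /= ? ?; lra.
have [g gB Eg] := expected_hitting_time_mean be0 massB.
have le_h : h x <= k + g x.
  apply: (hitting_mean_le_via hp hA gB k0) => y.
  by rewrite !inE -leNgt.
have : g x <= tb by rewrite -lee_fin -Eg; exact: tbmax.
by move: le_h; lra.
Qed.

End MaxHitting.

Theorem theorem1p3 (R : realType) (alpha beta : R)
    (halpha : 0 < alpha) (hab : alpha < beta) (hbeta : beta <= 1 / 2)
    (S : finType) (p : S -> S -> R) (pi : S -> R)
    (d : measure_display) (T : measurableType d)
    (Pr : S -> probability T R) (X : nat -> T -> S)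
    (hX : markov_chain p Pr X) (hirr : irreducible_chain p)
    (hpi : stationary_distribution p pi) :
  let Tmax := max_hitting_time Pr X pi in
  (Tmax alpha <= Tmax beta + (1 / alpha - 1)%R%:E * Tmax (1 - beta)%R
   /\
   Tmax beta + (1 / alpha - 1)%R%:E * Tmax (1 - beta)%R
     <= Tmax beta / alpha%:E)%E.
Proof.
move=> Tmax; rewrite {}/Tmax.
have al1 : alpha <= 1 by lra.
have be0 : 0 < beta by lra.
have be1 : beta < 1 by lra.
have fin := max_hitting_time_attained hX hirr hpi.
have [a [Ea _ _ _]] := fin _ halpha al1.
have [b [Eb b0 bmax _]] := fin _ be0 (ltW be1).
have [||c [Ec c0 _ [A [x [cA Ex]]]]] := fin (1 - beta); [lra|lra|].
have le_a := max_hitting_time_le_via hX hirr hpi halpha al1 be0 be1 Ea Eb Ec.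
have le_cb : c <= b by rewrite -lee_fin -Ex; apply: bmax; lra.
rewrite Ea Eb Ec -EFinM -EFinD; split; first by rewrite lee_fin.
rewrite inver gt_eqF // -EFinM lee_fin.
have -> : b / alpha = b + (1 / alpha - 1) * b by field; rewrite gt_eqF.
rewrite lerD2l ler_wpM2l //.
by rewrite subr_ge0 div1r -[leLHS]invr1 lef_pV2 ?posrE ?ltr01.
Qed.
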